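(* Let $(R_{\lambda})_{\lambda\in\Lambda}$ be a family of commutative rings and let $R=\prod_{\lambda\in\Lambda}R_{\lambda}$. Then $R$ is $1$-semiregular if and only if $R_{\lambda}$ is $1$-semiregular for each $\lambda\in\Lambda$.
   Context: All rings are commutative with identity and all modules are unitary. A ring $R$ is $1$-semiregular if every finitely presented $R$-module $M$ is $1$-periodic, i.e. there is an exact sequence $0\to M\to P\to M\to 0$ with $P$ projective. *)

(* Defs.v *)
From HB Require Import structures.
From mathcomp Require Import all_boot all_order all_algebra.
From mathcomp Require Import boolp.

Set Implicit Arguments.
Unset Strict Implicit.
Unset Printing Implicit Defensive.

Import GRing.Theory.
Local Open Scope ring_scope.

(* The zero ring is allowed (comPzRingType), so that the product over an
   empty index type is a ring as well. An alias is used because the library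
   only puts a ring structure on non-dependent function types. *)
Definition prod_ring (Lambda : Type) (R : Lambda -> comPzRingType) : Type :=
  forall l : Lambda, R l.

Section ProdRing.
Variables (Lambda : Type) (R : Lambda -> comPzRingType).
Implicit Types x y z : prod_ring R.

HB.instance Definition _ := Choice.copy (prod_ring R) (forall l : Lambda, R l).

Definition prod_ring_zero : prod_ring R := fun=> 0.
Definition prod_ring_one : prod_ring R := fun=> 1.
Definition prod_ring_opp x : prod_ring R := fun l => - x l.
Definition prod_ring_add x y : prod_ring R := fun l => x l + y l.
Definition prod_ring_mul x y : prod_ring R := fun l => x l * y l.

Fact prod_ring_addA : associative prod_ring_add.
Proof. by move=> x y z; apply: functional_extensionality_dep => l; apply: addrA. Qed.

Fact prod_ring_addC : commutative prod_ring_add.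
Proof. by move=> x y; apply: functional_extensionality_dep => l; apply: addrC. Qed.

Fact prod_ring_add0 : left_id prod_ring_zero prod_ring_add.
Proof. by move=> x; apply: functional_extensionality_dep => l; apply: add0r. Qed.

Fact prod_ring_addN : left_inverse prod_ring_zero prod_ring_opp prod_ring_add.
Proof. by move=> x; apply: functional_extensionality_dep => l; apply: addNr. Qed.

HB.instance Definition _ := GRing.isZmodule.Build (prod_ring R)
  prod_ring_addA prod_ring_addC prod_ring_add0 prod_ring_addN.

Fact prod_ring_mulA : associative prod_ring_mul.
Proof. by move=> x y z; apply: functional_extensionality_dep => l; apply: mulrA. Qed.

Fact prod_ring_mulC : commutative prod_ring_mul.
Proof. by move=> x y; apply: functional_extensionality_dep => l; apply: mulrC. Qed.

Fact prod_ring_mul1 : left_id prod_ring_one prod_ring_mul.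
Proof. by move=> x; apply: functional_extensionality_dep => l; apply: mul1r. Qed.

Fact prod_ring_mulD : left_distributive prod_ring_mul +%R.
Proof. by move=> x y z; apply: functional_extensionality_dep => l; apply: mulrDl. Qed.

HB.instance Definition _ := GRing.Zmodule_isComPzRing.Build (prod_ring R)
  prod_ring_mulA prod_ring_mulC prod_ring_mul1 prod_ring_mulD.

End ProdRing.

Section Modules.
Variable R : comPzRingType.

Definition surjective (A B : Type) (f : A -> B) : Prop :=
  forall b, exists a, f a = b.

(* Exactness of A -> B -> C at B. *)
Definition exact_at (A B C : lmodType R)
    (f : {linear A -> B}) (g : {linear B -> C}) : Prop :=
  forall b : B, g b = 0 <-> exists a : A, f a = b.

(* Exactness of 0 -> A -> B -> C -> 0. *)
Definition short_exact (A B C : lmodType R)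
    (f : {linear A -> B}) (g : {linear B -> C}) : Prop :=
  [/\ injective f, exact_at f g & surjective g].

(* M has a presentation R^m -> R^n -> M -> 0. *)
Definition finitely_presented (M : lmodType R) : Prop :=
  exists (m n : nat) (u : {linear 'rV[R]_m -> 'rV[R]_n})
         (p : {linear 'rV[R]_n -> M}),
    exact_at u p /\ surjective p.

Definition projective (P : lmodType R) : Prop :=
  forall (A B : lmodType R) (g : {linear A -> B}) (f : {linear P -> B}),
    surjective g -> exists h : {linear P -> A}, forall x : P, g (h x) = f x.

Definition periodic1 (M : lmodType R) : Prop :=
  exists (P : lmodType R) (f : {linear M -> P}) (g : {linear P -> M}),
    projective P /\ short_exact f g.

End Modules.

Definition semiregular1 (R : comPzRingType) : Prop :=
  forall M : lmodType R, finitely_presented M -> periodic1 M.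

(* Main.v *)
Require Import Defs.
From HB Require Import structures.
From mathcomp Require Import all_boot all_order all_algebra.
From mathcomp Require Import boolp.

Set Implicit Arguments.
Unset Strict Implicit.
Unset Printing Implicit Defensive.

Import GRing.Theory.
Local Open Scope ring_scope.

(** Let [A] be the product ring and [idem l] the idempotent of [A] that is [1] at
    [l] and [0] elsewhere. Two functors relate [A]-modules and [R l]-modules:
    [component l M], the part of [M] fixed by [idem l], and [restriction N],
    which is [N] seen as an [A]-module through the projection to [R l]. Both
    preserve finite presentation ([finitely_presented_component],
    [finitely_presented_restriction]), and the component functor is exact and
    preserves projectivity, so it preserves 1-periodicity
    ([periodic1_component]).

    If [A] is 1-semiregular and [N] is a finitely presented [R l]-module, then
    [restriction N] is 1-periodic over [A], and so is its component over [R l];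
    this component is [N] itself ([component_restriction_bij]).

    Conversely, let every [R l] be 1-semiregular and [M] be a finitely presented
    [A]-module. Each component of [M] sits in an exact sequence with middle term
    a projective [P l], and the product of these sequences is exact. Two points
    need finiteness. First, [M] is the product of its components
    ([components_bij]): in a presentation, both the relations witnessing that
    an element vanishes and the generators' coefficients of a family of
    elements can be chosen index by index and glued. Second, the product of the
    [P l] is projective ([projective_prod]): an infinite product of projectives
    over the factors has no reason to be one unless the numbers of generators are
    bounded, but if [M] has [n] generators then so does each component, and the
    extension [P l] has [2n] of them ([extension_generated]). *)

(** * Linear maps, projectives and periodicity *)

Section Generalities.
Variable R : comPzRingType.

Definition linear_of (U V : lmodType R) (f : U -> V) (lin_f : linear f) :
    {linear U -> V} :=
  HB.pack f (GRing.isLinear.Build _ _ _ _ f lin_f).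

Lemma linear_inverse (M N : lmodType R) (f : {linear M -> N}) :
  injective f -> surjective f ->
  exists2 g : {linear N -> M}, cancel f g & cancel g f.
Proof.
move=> f_inj /choice[g gK].
have lin_g : linear g by move=> a u v; apply: f_inj; rewrite linearP !gK.
by exists (linear_of lin_g) => // x; apply: f_inj; rewrite gK.
Qed.

Lemma periodic1_iso (M N : lmodType R) (f : {linear M -> N}) :
  injective f -> surjective f -> periodic1 N -> periodic1 M.
Proof.
move=> f_inj f_surj [P [i [q [Pproj [i_inj iq_exact q_surj]]]]].
have [g fK gK] := linear_inverse f_inj f_surj.
exists P, (i \o f), (g \o q); split=> //; split.
- exact: inj_comp.
- move=> b; split=> /= [gq0 | [a <-]].
    have /iq_exact[c <-] : q b = 0 by rewrite -[q b]gK gq0 linear0.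
    by exists (g c); rewrite gK.
  by rewrite (iq_exact _).2 ?linear0//; exists (f a).
- by move=> x; have [p /= qp] := q_surj (f x); exists p; rewrite /= qp fK.
Qed.

(** A linear map out of a free module is determined by arbitrary values on the
    basis, so a lift is obtained by lifting the basis vectors one by one. *)
Lemma projective_free n : projective 'rV[R]_n.
Proof.
move=> A B g f /choice[s sK].
pose h (x : 'rV[R]_n) := \sum_(j < n) x 0 j *: s (f 'e_j).
have lin_h : linear h.
  move=> a x y; rewrite scaler_sumr -big_split; apply: eq_bigr => j _ /=.
  by rewrite !mxE scalerDl scalerA.
exists (linear_of lin_h) => x /=.
rewrite [in RHS](row_sum_delta x) !linear_sum; apply: eq_bigr => j _.
by rewrite !linearZ /= sK.
Qed.

Lemma projective_retract (P Q : lmodType R)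
    (i : {linear Q -> P}) (r : {linear P -> Q}) :
  cancel i r -> projective P -> projective Q.
Proof.
move=> iK Pproj A B g f g_surj.
have [h gh] := Pproj A B g (f \o r) g_surj.
by exists (h \o i) => x; rewrite /= gh /= iK.
Qed.

(** The horseshoe argument: the [n] generators of the submodule together with
    lifts of the [n] generators of the quotient generate the middle term. *)
Lemma extension_generated (M P : lmodType R) n (p : {linear 'rV[R]_n -> M})
    (i : {linear M -> P}) (q : {linear P -> M}) :
  surjective p -> short_exact i q ->
  exists t : {linear 'rV[R]_(n + n) -> P}, surjective t.
Proof.
move=> p_surj [_ iq_exact q_surj].
have [s qs] := projective_free p q_surj.
pose t (x : 'rV[R]_(n + n)) := i (p (lsubmx x)) + s (rsubmx x).
have lin_t : linear t.
  by move=> a x y; rewrite /t !linearP /= scalerDr addrACA.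
exists (linear_of lin_t) => z /=.
have [y py] := p_surj (q z).
have /iq_exact[m im] : q (z - s y) = 0 by rewrite linearB /= qs py subrr.
have [x px] := p_surj m.
by exists (row_mx x y); rewrite /t row_mxKl row_mxKr px im subrK.
Qed.

End Generalities.

Section Product.
Variables (Lambda : Type) (R : Lambda -> comPzRingType).
Local Notation A := (prod_ring R).

(** * The factor rings and their idempotents *)

(** The alias [{classic Lambda}] supplies the decidable equality on indices. *)
Definition prod_inj (l : Lambda) (r : R l) : A :=
  @dfwith {classic Lambda} R (0 : A) l r.

Lemma prod_inj_same l (r : R l) : prod_inj r l = r.
Proof. exact: (@dfwith_in {classic Lambda}). Qed.

Lemma prod_inj_other l k (r : R l) : l <> k -> prod_inj r k = 0.
Proof. by move=> lk; apply: (@dfwith_out {classic Lambda}); apply/eqP. Qed.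

Lemma prod_ringP (a b : A) : (forall l, a l = b l) -> a = b.
Proof. exact: functional_extensionality_dep. Qed.

(** This is [A]-linearity of [prod_inj], for the action of [A] on [R l] through
    the projection; it embeds [R l] as an ideal of [A] and does not preserve 1
    in general. *)
Lemma mul_prod_inj l (a : A) (r : R l) : a * prod_inj r = prod_inj (a l * r).
Proof.
apply: prod_ringP => k; rewrite /GRing.mul /= /prod_ring_mul.
have [E|lk] := pselect (l = k); last by rewrite !prod_inj_other ?mulr0.
by case: k / E; rewrite !prod_inj_same.
Qed.

Lemma prod_inj_add l : {morph @prod_inj l : r s / r + s}.
Proof.
move=> r s; apply: prod_ringP => k.
change (prod_inj (r + s) k = prod_inj r k + prod_inj s k).
have [E|lk] := pselect (l = k); last by rewrite !prod_inj_other// addr0.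
by case: k / E; rewrite !prod_inj_same.
Qed.

Definition idem l : A := prod_inj (1 : R l).

Lemma idem_same l : idem l l = 1.
Proof. exact: prod_inj_same. Qed.

Lemma mul_idem l (a : A) : a * idem l = prod_inj (a l).
Proof. by rewrite mul_prod_inj mulr1. Qed.

(** * Row vectors over the product ring *)

Definition row_inj l n (x : 'rV[R l]_n) : 'rV[A]_n := map_mx (@prod_inj l) x.
Definition row_proj l n (x : 'rV[A]_n) : 'rV[R l]_n :=
  map_mx (fun a : A => a l) x.
Definition row_glue n (x : forall l, 'rV[R l]_n) : 'rV[A]_n :=
  \row_j (fun l => x l 0 j).

Lemma row_injK l n (x : 'rV[R l]_n) : row_proj l (row_inj x) = x.
Proof. by apply/rowP => j; rewrite !mxE prod_inj_same. Qed.

Lemma row_projK l n (x : 'rV[A]_n) : row_inj (row_proj l x) = idem l *: x.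
Proof. by apply/rowP => j; rewrite !mxE mulrC mul_idem. Qed.

Lemma row_glueK n (x : forall l, 'rV[R l]_n) l : row_proj l (row_glue x) = x l.
Proof. by apply/rowP => j; rewrite !mxE. Qed.

Lemma row_projP n (x y : 'rV[A]_n) :
  (forall l, row_proj l x = row_proj l y) -> x = y.
Proof.
move=> xy; apply/rowP => j; apply: prod_ringP => l.
by have /rowP/(_ j) := xy l; rewrite !mxE.
Qed.

Lemma row_proj_linear l n a (x y : 'rV[A]_n) :
  row_proj l (a *: x + y) = a l *: row_proj l x + row_proj l y.
Proof. by apply/rowP => j; rewrite !mxE. Qed.

(** The scalar is written [b l] because any lift [b] of it acts in the same way on
    the image of [row_inj]; a lift of a given [r] is [prod_inj r]. *)
Lemma row_inj_linear l n (b : A) (x y : 'rV[R l]_n) :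
  row_inj (b l *: x + y) = b *: row_inj x + row_inj y.
Proof. by apply/rowP => j; rewrite !mxE prod_inj_add -mul_prod_inj. Qed.

Lemma row_proj_idem l n (x : 'rV[A]_n) : row_proj l (idem l *: x) = row_proj l x.
Proof. by rewrite -row_projK row_injK. Qed.

(** * The component of a module at an index *)

Section Component.
Variables (l : Lambda) (M : lmodType A).

Definition fixed_by_idem : pred M := fun x => idem l *: x == x.

Fact fixed_by_idem_zmod : zmod_closed fixed_by_idem.
Proof.
split=> [|x y]; rewrite !unfold_in /fixed_by_idem; first by rewrite scaler0.
by move=> /eqP ex /eqP ey; rewrite scalerBr ex ey.
Qed.

HB.instance Definition _ :=
  GRing.isZmodClosed.Build M fixed_by_idem fixed_by_idem_zmod.

Definition component := {x : M | x \in fixed_by_idem}.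

HB.instance Definition _ := SubChoice.on component.
HB.instance Definition _ := [SubChoice_isSubZmodule of component by <:].

Lemma val_componentD (x y : component) : val (x + y) = val x + val y.
Proof. exact: raddfD. Qed.

Lemma component_fixed (x : component) : idem l *: val x = val x.
Proof. exact/eqP/(valP x). Qed.

Fact component_proj_subproof (x : M) : idem l *: x \in fixed_by_idem.
Proof.
by rewrite unfold_in /fixed_by_idem scalerA mul_idem idem_same.
Qed.

Definition component_proj (x : M) : component :=
  Sub (idem l *: x) (component_proj_subproof x).

(** The vector [prod_inj r *: val x] already lies in the component; projecting it
    only supplies the membership proof (see [val_component_scale]). *)
Definition component_scale (r : R l) (x : component) : component :=
  component_proj (prod_inj r *: val x).

Lemma val_component_scale r x : val (component_scale r x) = prod_inj r *: val x.
Proof. by rewrite /= scalerA mulrC mul_idem prod_inj_same. Qed.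

Fact component_scaleA r s x :
  component_scale r (component_scale s x) = component_scale (r * s) x.
Proof.
apply: val_inj; rewrite !val_component_scale scalerA mul_prod_inj.
by rewrite prod_inj_same.
Qed.

Fact component_scale1 : left_id 1 component_scale.
Proof. by move=> x; apply: val_inj; rewrite val_component_scale component_fixed. Qed.

Fact component_scaleDr : right_distributive component_scale +%R.
Proof.
by move=> r x y; apply: val_inj; rewrite val_componentD !val_component_scale
  val_componentD scalerDr.
Qed.

Fact component_scaleDl x : {morph component_scale^~ x : r s / r + s}.
Proof.
by move=> r s; apply: val_inj; rewrite val_componentD !val_component_scale
  prod_inj_add scalerDl.
Qed.

HB.instance Definition _ := GRing.Zmodule_isLmodule.Build (R l) component
  component_scaleA component_scale1 component_scaleDr component_scaleDl.

Lemma val_componentZ (r : R l) (x : component) : val (r *: x) = prod_inj r *: val x.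
Proof. exact: val_component_scale. Qed.

(** Any lift [a] of the scalar [a l] acts on the component. *)
Lemma val_component_linear (a : A) (x y : component) :
  val (a l *: x + y) = a *: val x + val y.
Proof.
by rewrite val_componentD val_componentZ -mul_idem -scalerA component_fixed.
Qed.

Lemma component_proj_linear (a : A) (x y : M) :
  component_proj (a *: x + y) = a l *: component_proj x + component_proj y.
Proof.
by apply: val_inj; rewrite val_component_linear /= scalerDr !scalerA mulrC.
Qed.

Lemma component_projK (x : component) : component_proj (val x) = x.
Proof. by apply: val_inj; rewrite /= component_fixed. Qed.

End Component.

(** * Restriction of scalars along a projection *)

Section Restriction.
Variables (l : Lambda) (N : lmodType (R l)).

(** An alias, so that the same group can carry a module structure over [A]. *)
Definition restriction : Type := N.

HB.instance Definition _ := GRing.Zmodule.copy restriction N.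

Definition restriction_scale (a : A) (x : restriction) : restriction :=
  (a l *: (x : N) : N).

Fact restriction_scaleA a b x :
  restriction_scale a (restriction_scale b x) = restriction_scale (a * b) x.
Proof. exact: scalerA. Qed.

Fact restriction_scale1 : left_id 1 restriction_scale.
Proof. exact: (@scale1r _ N). Qed.

Fact restriction_scaleDr : right_distributive restriction_scale +%R.
Proof. by move=> a x y; apply: (@scalerDr _ N). Qed.

Fact restriction_scaleDl x : {morph restriction_scale^~ x : a b / a + b}.
Proof. by move=> a b; apply: (@scalerDl _ N). Qed.

HB.instance Definition _ := GRing.Zmodule_isLmodule.Build A restriction
  restriction_scaleA restriction_scale1 restriction_scaleDr restriction_scaleDl.

End Restriction.

(** [R l] is the quotient of [A] by the ideal generated by [1 - idem l].  Hence
    a presentation of [N] by [m] relations lifts to one over [A] by adding the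
    relations that [1 - idem l] kills each of the [n] generators. *)
Lemma finitely_presented_restriction l (N : lmodType (R l)) :
  finitely_presented N -> finitely_presented (restriction N).
Proof.
move=> [m [n [u [p [up_exact p_surj]]]]].
pose U (z : 'rV[A]_(m + n)) : 'rV[A]_n :=
  row_inj (u (row_proj l (lsubmx z))) + (1 - idem l) *: rsubmx z.
pose P (x : 'rV[A]_n) : restriction N := p (row_proj l x).
have lin_U : linear U.
  move=> a x y; rewrite /U !(linearP lsubmx) !(linearP rsubmx) row_proj_linear.
  by rewrite linearP row_inj_linear !scalerDr !scalerA [_ * a]mulrC addrACA.
have lin_P : linear P by move=> a x y; rewrite /P row_proj_linear linearP.
exists (m + n)%N, n, (linear_of lin_U), (linear_of lin_P); split=> /=.
  move=> b; split=> [/up_exact[y uy]|[z <-]].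
    exists (row_mx (row_inj y) b).
    rewrite /= /U row_mxKl row_mxKr row_injK uy row_projK scalerBl scale1r.
    by rewrite addrC subrK.
  rewrite /= /P; apply/up_exact; exists (row_proj l (lsubmx z)).
  rewrite /U addrC row_proj_linear row_injK [X in X *: _](_ : _ = 0).
    by rewrite scale0r add0r.
  by change (1 - idem l l = 0); rewrite idem_same subrr.
move=> x; have [y py] := p_surj x.
by exists (row_inj y); rewrite /= /P row_injK.
Qed.

(** * Taking components is exact and preserves projectivity *)

Lemma component_map_linear l (M N : lmodType A) (f : {linear M -> N}) :
  linear (fun x : component l M => component_proj l (f (val x))).
Proof.
move=> r x y; rewrite -[r](prod_inj_same r) val_component_linear linearP.
exact: component_proj_linear.
Qed.

Definition component_map l (M N : lmodType A) (f : {linear M -> N}) :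
    {linear component l M -> component l N} :=
  linear_of (@component_map_linear l M N f).

Lemma val_component_map l (M N : lmodType A) (f : {linear M -> N})
    (x : component l M) :
  val (component_map l f x) = f (val x).
Proof. by rewrite /= -linearZ /= component_fixed. Qed.

Lemma short_exact_component l (M P N : lmodType A)
    (i : {linear M -> P}) (q : {linear P -> N}) :
  short_exact i q -> short_exact (component_map l i) (component_map l q).
Proof.
move=> [i_inj iq_exact q_surj]; split.
- move=> x y /(congr1 val); rewrite !val_component_map => /i_inj.
  exact: val_inj.
- move=> b; split=> [/(congr1 val) | [a <-]].
    rewrite val_component_map => /iq_exact[a ia].
    exists (component_proj l a); apply: val_inj; rewrite val_component_map.
    by rewrite /= linearZ /= ia component_fixed.
  apply: val_inj; rewrite !val_component_map; apply/iq_exact.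
  by exists (val a).
- move=> b; have [a qa] := q_surj (val b).
  exists (component_proj l a); apply: val_inj; rewrite val_component_map.
  by rewrite /= linearZ /= qa component_fixed.
Qed.

(** Taking the component is left adjoint to restriction, and restriction
    preserves surjections: a lifting problem for [component l P] over [R l]
    becomes one for [P] over [A]. *)
Lemma projective_component l (P : lmodType A) :
  projective P -> projective (component l P).
Proof.
move=> Pproj B C g f g_surj.
have lin_g : linear (g : restriction B -> restriction C).
  by move=> a x y; apply: linearP.
have lin_f : linear (fun x : P => f (component_proj l x) : restriction C).
  by move=> a x y; rewrite component_proj_linear linearP.
have [h gh] := Pproj _ _ (linear_of lin_g) (linear_of lin_f) g_surj.
have lin_h : linear (fun x : component l P => h (val x) : B).
  move=> r x y; rewrite -[r in LHS](prod_inj_same r) val_component_linear.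
  by rewrite linearP -[r in RHS](prod_inj_same r).
exists (linear_of lin_h) => x.
by rewrite /= [LHS]gh /= component_projK.
Qed.

Lemma periodic1_component l (M : lmodType A) :
  periodic1 M -> periodic1 (component l M).
Proof.
move=> [P [i [q [Pproj iq]]]].
exists (component l P), (component_map l i), (component_map l q).
by split; [apply: projective_component | apply: short_exact_component].
Qed.

Section ComponentGenerators.
Variables (l : Lambda) (M : lmodType A) (n : nat) (p : {linear 'rV[A]_n -> M}).

Lemma component_gens_linear :
  linear (fun x : 'rV[R l]_n => component_proj l (p (row_inj x))).
Proof.
move=> r x y; rewrite -[r](prod_inj_same r) row_inj_linear linearP.
exact: component_proj_linear.
Qed.

Definition component_gens : {linear 'rV[R l]_n -> component l M} :=
  linear_of component_gens_linear.

Lemma val_component_gens x : val (component_gens x) = p (row_inj x).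
Proof. by rewrite /= -linearZ -row_projK row_injK. Qed.

Lemma component_gens_surj : surjective p -> surjective component_gens.
Proof.
move=> p_surj x; have [y py] := p_surj (val x).
exists (row_proj l y); apply: val_inj.
by rewrite val_component_gens row_projK linearZ /= py component_fixed.
Qed.

End ComponentGenerators.

(** Multiplying a solution of [u y = x] by [idem l] solves the same equation for
    [idem l *: x], so the relations of the component are the [l]-th projections
    of the relations [u]. *)
Lemma finitely_presented_component l (M : lmodType A) :
  finitely_presented M -> finitely_presented (component l M).
Proof.
move=> [m [n [u [p [up_exact p_surj]]]]].
pose U (y : 'rV[R l]_m) : 'rV[R l]_n := row_proj l (u (row_inj y)).
have lin_U : linear U.
  move=> r x y; rewrite /U -[r](prod_inj_same r) row_inj_linear linearP.
  exact: row_proj_linear.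
exists m, n, (linear_of lin_U), (component_gens l p).
split; last exact: component_gens_surj.
move=> b; split=> [/(congr1 val)|[y <-]].
  rewrite val_component_gens => /up_exact[y uy]; exists (row_proj l y).
  by rewrite /= /U row_projK linearZ /= uy row_proj_idem row_injK.
apply: val_inj; rewrite val_component_gens; apply/up_exact.
by exists (idem l *: row_inj y); rewrite linearZ /= row_projK.
Qed.

Lemma component_proj_restriction_linear l (N : lmodType (R l)) :
  linear (fun x : N => component_proj l (x : restriction N)).
Proof.
by move=> r x y; rewrite -[r](prod_inj_same r) -component_proj_linear.
Qed.

(** [idem l] acts on [restriction N] as [1]. *)
Lemma component_restriction_bij l (N : lmodType (R l)) :
  let f := linear_of (@component_proj_restriction_linear l N) in
  injective f /\ surjective f.
Proof.
have idem_act (x : restriction N) : idem l *: x = x.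
  by change (idem l l *: (x : N) = x); rewrite idem_same scale1r.
split=> [x y /(congr1 val) /= | y]; first by rewrite !idem_act.
by exists (val y); rewrite /= component_projK.
Qed.

(** * Products of modules over the factors *)

Section ProductModule.
Variable P : forall l, lmodType (R l).

Definition prod_mod : Type := forall l, P l.

Implicit Types x y z : prod_mod.

HB.instance Definition _ := Choice.copy prod_mod (forall l, P l).

Definition prod_mod_zero : prod_mod := fun=> 0.
Definition prod_mod_opp x : prod_mod := fun l => - x l.
Definition prod_mod_add x y : prod_mod := fun l => x l + y l.
Definition prod_mod_scale (a : A) x : prod_mod := fun l => a l *: x l.

Lemma prod_modP x y : (forall l, x l = y l) -> x = y.
Proof. exact: functional_extensionality_dep. Qed.

Fact prod_mod_addA : associative prod_mod_add.
Proof. by move=> x y z; apply: prod_modP => l; apply: addrA. Qed.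

Fact prod_mod_addC : commutative prod_mod_add.
Proof. by move=> x y; apply: prod_modP => l; apply: addrC. Qed.

Fact prod_mod_add0 : left_id prod_mod_zero prod_mod_add.
Proof. by move=> x; apply: prod_modP => l; apply: add0r. Qed.

Fact prod_mod_addN : left_inverse prod_mod_zero prod_mod_opp prod_mod_add.
Proof. by move=> x; apply: prod_modP => l; apply: addNr. Qed.

HB.instance Definition _ := GRing.isZmodule.Build prod_mod
  prod_mod_addA prod_mod_addC prod_mod_add0 prod_mod_addN.

Fact prod_mod_scaleA a b x :
  prod_mod_scale a (prod_mod_scale b x) = prod_mod_scale (a * b) x.
Proof. by apply: prod_modP => l; apply: scalerA. Qed.

Fact prod_mod_scale1 : left_id 1 prod_mod_scale.
Proof. by move=> x; apply: prod_modP => l; apply: scale1r. Qed.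

Fact prod_mod_scaleDr : right_distributive prod_mod_scale +%R.
Proof. by move=> a x y; apply: prod_modP => l; apply: scalerDr. Qed.

Fact prod_mod_scaleDl x : {morph prod_mod_scale^~ x : a b / a + b}.
Proof. by move=> a b; apply: prod_modP => l; apply: scalerDl. Qed.

HB.instance Definition _ := GRing.Zmodule_isLmodule.Build A prod_mod
  prod_mod_scaleA prod_mod_scale1 prod_mod_scaleDr prod_mod_scaleDl.

End ProductModule.

Lemma prod_map_linear (M N : forall l, lmodType (R l))
    (f : forall l, {linear M l -> N l}) :
  linear (fun x : prod_mod M => (fun l => f l (x l)) : prod_mod N).
Proof. by move=> a x y; apply: prod_modP => l; apply: linearP. Qed.

Definition prod_map (M N : forall l, lmodType (R l))
    (f : forall l, {linear M l -> N l}) : {linear prod_mod M -> prod_mod N} :=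
  linear_of (prod_map_linear f).

Lemma short_exact_prod (M P N : forall l, lmodType (R l))
    (i : forall l, {linear M l -> P l}) (q : forall l, {linear P l -> N l}) :
  (forall l, short_exact (i l) (q l)) -> short_exact (prod_map i) (prod_map q).
Proof.
move=> iq; split.
- move=> x y xy; apply: prod_modP => l; have [i_inj _ _] := iq l.
  exact/i_inj/(congr1 (fun z : prod_mod P => z l) xy).
- move=> b; split=> [qb0 | [a <-]].
    have /all_sig[a ia] l : {a | i l a = b l}.
      apply: cid; have [_ iq_exact _] := iq l.
      exact/iq_exact/(congr1 (fun z : prod_mod N => z l) qb0).
    by exists a; apply: prod_modP.
  apply: prod_modP => l; have [_ iq_exact _] := iq l.
  by apply/iq_exact; exists (a l).
- move=> b; have /all_sig[a qa] l : {a | q l a = b l}.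
    by apply: cid; have [_ _ q_surj] := iq l.
  by exists a; apply: prod_modP.
Qed.

(** The number [n] of generators is the same for all factors, so the product is a retract of the free module of rank [n], which is the
    product of the free modules of rank [n] over the factors. *)
Lemma projective_prod (P : forall l, lmodType (R l)) n
    (t : forall l, {linear 'rV[R l]_n -> P l}) :
  (forall l, surjective (t l)) -> (forall l, projective (P l)) ->
  projective (prod_mod P).
Proof.
move=> t_surj Pproj.
have /all_sig[s sK] l : {s : {linear P l -> 'rV[R l]_n} | cancel s (t l)}.
  by apply: cid; have [s ts] := Pproj l _ _ (t l) idfun (t_surj l); exists s.
have lin_s : linear (fun x : prod_mod P => row_glue (fun l => s l (x l))).
  move=> a x y; apply: row_projP => l.
  by rewrite row_proj_linear !row_glueK linearP.
have lin_t : linear (fun x => (fun l => t l (row_proj l x)) : prod_mod P).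
  by move=> a x y; apply: prod_modP => l; rewrite row_proj_linear linearP.
apply: (@projective_retract _ _ _ (linear_of lin_s) (linear_of lin_t)).
  by move=> x; apply: prod_modP => l /=; rewrite row_glueK sK.
exact: projective_free.
Qed.

(** * A finitely presented module is the product of its components *)

Lemma components_linear (M : lmodType A) :
  linear (fun x : M => (fun l => component_proj l x)
                         : prod_mod (fun l => component l M)).
Proof. by move=> a x y; apply: prod_modP => l; apply: component_proj_linear. Qed.

(** For injectivity, an element [p z] with zero components has every
    [idem l *: z] among the relations, and gluing the [l]-th projections of the
    witnesses shows that [z] is a relation. For surjectivity, gluing preimages
    in the free module requires that it have finite rank. *)
Lemma components_bij (M : lmodType A) : finitely_presented M ->
  let f := linear_of (@components_linear M) in injective f /\ surjective f.
Proof.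
move=> [m [n [u [p [up_exact p_surj]]]]] f; split.
  suff f_ker x : f x = 0 -> x = 0.
    by move=> x y fxy; apply/subr0_eq/f_ker; rewrite linearB fxy subrr.
  have [z <-] := p_surj x => fz0; apply/up_exact.
  have /all_sig[y uy] l : {y | u y = idem l *: z}.
    apply/cid/up_exact; rewrite linearZ /=.
    have /= -> :=
      congr1 (fun w : prod_mod (fun k => component k M) => val (w l)) fz0.
    exact: (raddf0 (val : component l M -> M)).
  exists (row_glue (fun l => row_proj l (y l))); apply: row_projP => l.
  rewrite -(row_proj_idem l (u _)) -linearZ /= -row_projK row_glueK.
  by rewrite row_projK linearZ /= uy !row_proj_idem.
move=> b; have /all_sig[x px] l : {x | p x = val (b l)} by exact/cid.
exists (p (row_glue (fun l => row_proj l (x l)))); apply: prod_modP => l.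
apply: val_inj; rewrite /= -linearZ /= -row_projK row_glueK row_projK.
by rewrite linearZ /= px component_fixed.
Qed.

Lemma semiregular1_factor l : semiregular1 A -> semiregular1 (R l).
Proof.
move=> srA N /finitely_presented_restriction/srA Nper.
have [f_inj f_surj] := component_restriction_bij N.
exact: periodic1_iso f_inj f_surj (periodic1_component l Nper).
Qed.

Lemma semiregular1_prod : (forall l, semiregular1 (R l)) -> semiregular1 A.
Proof.
move=> srR M Mfp; have [f_inj f_surj] := components_bij Mfp.
apply: periodic1_iso f_inj f_surj _.
have [_ [n [_ [p [_ p_surj]]]]] := Mfp.
have per l := cid (srR l _ (finitely_presented_component l Mfp)).
pose P l := sval (per l).
have /all_sig[i iP] l := cid (svalP (per l)).
have /all_sig[q iqP] l := cid (iP l).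
have iq l : short_exact (i l) (q l) by have [] := iqP l.
have /all_sig[t t_surj] l := cid
  (extension_generated (component_gens_surj (l := l) p_surj) (iq l)).
exists (prod_mod P), (prod_map i), (prod_map q); split.
  by apply: (projective_prod t_surj) => l; have [] := iqP l.
exact: short_exact_prod.
Qed.

End Product.

Theorem proposition3p1 (Lambda : Type) (R : Lambda -> comPzRingType) :
  semiregular1 (prod_ring R) <-> forall l : Lambda, semiregular1 (R l).
Proof.
by split=> [srA l|]; [apply: semiregular1_factor | apply: semiregular1_prod].
Qed.
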